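(* Let $G$ be a finite group, $m$ an integer and $d$ a positive integer. Then $\nu_m(g,\eta)\in\mathbb Q(\zeta_d)$ for all $g\in G$ and $\eta\in\mathrm{Irr}(C_G(g))$ if and only if $\beta_m(z,\chi)\in\mathbb Q(\zeta_d)$ for all $z\in G$ and $\chi\in\mathrm{Irr}(C_G(z))$.
   Context: $\mathbb Q(\zeta_d)$ is the $d$-th cyclotomic field; $C_G(g)$ is the centralizer of $g$; $\mathrm{Irr}(H)$ is the set of irreducible complex characters of $H$. $\nu_m(g,\eta)$ denotes the $m$-th (higher) Frobenius-Schur indicator of the module over the Drinfeld double $D(G)$ (over $\mathbb C$) associated to $g\in G$ and the character $\eta$ of $C_G(g)$; by a known result of Kashina-Sommerhäuser-Zhu, which may be taken as the definition, $\nu_m(g,\eta)=\frac1{|C_G(g)|}\sum_{x\in G,\ x^m=(gx)^m}\eta(x^m)$. For $z\in G$ the class function $\gamma_m^z\colon C_G(z)\to\mathbb C$ is $\gamma_m^z(g)=|\{x\in G\mid x^m=(gx)^m=z\}|$, and the coefficients $\beta_m(z,\chi)\in\mathbb C$ are defined by $\gamma_m^z=\sum_{\chi\in\mathrm{Irr}(C_G(z))}\beta_m(z,\chi)\,\chi$. *)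

(* Defs.v *)
From HB Require Import structures.
From mathcomp Require Import all_boot all_order all_algebra.
From mathcomp Require Import all_fingroup all_solvable all_field all_character.

Set Implicit Arguments.
Unset Strict Implicit.
Unset Printing Implicit Defensive.

Import Order.TTheory GRing.Theory Num.Theory GroupScope.
Local Open Scope ring_scope.

(* The underlying functions of characters take values in [algC], the field of
   algebraic complex numbers, which contains every value considered here. *)

Definition zexpg (gT : finGroupType) (x : gT) (m : int) : gT :=
  match m with
  | Posz n => (x ^+ n)%g
  | Negz n => (x ^- n.+1)%g
  end.

Lemma zexpgJ (gT : finGroupType) (x y : gT) (m : int) :
  zexpg (x ^ y)%g m = (zexpg x m ^ y)%g.
Proof. by case: m => n /=; rewrite ?conjVg conjXg. Qed.

(* Membership in the subfield Q(z) of [algC] generated by z, as the set of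
   fractions p(z) / q(z) with rational polynomials p, q and q(z) != 0. *)
Definition in_Qadjoin (z x : algC) : Prop :=
  exists p q : {poly rat},
    (map_poly ratr q).[z] != 0 /\
    x = (map_poly ratr p).[z] / (map_poly ratr q).[z].

Section Indicators.

Variables (gT : finGroupType) (G : {group gT}).

(* The m-th Frobenius-Schur indicator of the D(G)-module attached to g and eta,
   by the formula of Kashina, Sommerhaeuser and Zhu.
   If x^m = (g x)^m then x^m commutes with x and with g x, hence with g, so
   [eta] is only evaluated inside its domain 'C_G[g]. *)
Definition FSind (m : int) (g : gT) (eta : 'CF('C_G[g])) : algC :=
  #|'C_G[g]|%:R^-1 *
    \sum_(x in G | zexpg x m == zexpg (g * x)%g m) eta (zexpg x m).

Definition gamma_set (m : int) (z g : gT) : {set gT} :=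
  [set x in G | (zexpg x m == z) && (zexpg (g * x)%g m == z)].

(* An element of 'CF('C_G[z]) is a function on the whole of gT vanishing
   outside 'C_G[z], whence the cut-off by (g \in 'C_G[z]). *)
Fact FSgamma_subproof (m : int) (z : gT) :
  is_class_fun <<'C_G[z]>>
    [ffun g => #|gamma_set m z g|%:R *+ (g \in 'C_G[z])].
Proof.
rewrite genGid; apply: intro_class_fun => [g y Cg Cy | g /negPf-> //].
rewrite groupJr // Cg; congr (_%:R *+ _).
have [Gy /cent1P czy] := setIP Cy.
rewrite -(card_imset (gamma_set m z g) (conjg_inj y)); congr #|pred_of_set _|.
apply/setP=> x; rewrite -[x](conjgKV y).
rewrite (mem_imset _ _ (@conjg_inj _ y)); set u := (x ^ y^-1)%g.
have zJ (t : gT) : (t ^ y == z)%g = (t == z).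
  have {1}<- : (z ^ y)%g = z by rewrite conjgE -czy mulKg.
  by rewrite (inj_eq (conjg_inj y)).
by rewrite !inE -conjMg !zexpgJ !zJ groupJr.
Qed.

Definition FSgamma (m : int) (z : gT) : 'CF('C_G[z]) :=
  Cfun 1 (FSgamma_subproof m z).

(* The coefficient of 'chi_i in the expansion of [FSgamma m z] in the basis
   [irr 'C_G[z]]. *)
Definition FSbeta (m : int) (z : gT) (i : Iirr 'C_G[z]) : algC :=
  coord (irr 'C_G[z]) i (FSgamma m z).

End Indicators.

(* Main.v *)
Require Import Defs.
From HB Require Import structures.
From mathcomp Require Import all_boot all_order all_algebra.
From mathcomp Require Import all_fingroup all_solvable all_field all_character.

Set Implicit Arguments.
Unset Strict Implicit.
Unset Printing Implicit Defensive.

Import Order.TTheory GRing.Theory Num.Theory GroupScope.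
Local Open Scope ring_scope.

(* Let R_z be the set of m-th roots of z in G. Then gamma_m^z(g) counts the
   factorizations g = y x^-1 with x, y in R_z, so Schur's lemma gives
     beta_m(z, chi) = chi(R_z) chi(R_z^-1) / (|C_G(z)| chi(1)),
   where chi(A) is the sum of chi over A. A Galois automorphism raising |G|-th
   roots of unity to the k-th power sends chi(x) to chi(x^k), hence
   beta_m(z, chi) to chi(R_{z^k}) chi(R_{z^k}^-1) / (|C_G(z)| chi(1)); this
   amounts to the symmetry F(g^k, z^k) = F(g, z) of F(g, z) := gamma_m^z(g).
   On the other hand, the indicators nu_m(g, eta) are the Fourier coefficients of
   F(g, z) as a function of z, and the beta_m(z, chi) those of F(g, z) as a
   function of g, so they all lie in Q(zeta_d) if and only if, for all k coming
   from automorphisms fixing zeta_d, F(g, z^k) = F(g, z), respectively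
   F(g^k, z) = F(g, z). By the symmetry these conditions are equivalent. *)

(** * Galois criterion for membership in Q(zeta) *)

Lemma in_QadjoinP (Qn : splittingFieldType rat) (QnC : {rmorphism Qn -> algC})
    (a b : Qn) : galois 1 {:Qn} ->
  in_Qadjoin (QnC b) (QnC a) <->
  (forall u : {rmorphism algC -> algC},
     u (QnC b) = QnC b -> u (QnC a) = QnC a).
Proof.
move=> galQ; split=> [[p [q [_ ->]]] u ub | fix_a].
  have uE (r : {poly rat}) :
      u (map_poly ratr r).[QnC b] = (map_poly ratr r).[QnC b].
    rewrite -horner_map /= ub -map_poly_comp; congr _.[_].
    by apply: eq_map_poly => c /=; rewrite fmorph_rat.
  by rewrite fmorph_div !uE.
(* Galois correspondence over Q(b): automorphisms of [Qn] fixing b extend to [algC], so [fix_a] puts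
   a in their fixed field. *)
have galb: galois <<1; b>> {:Qn}.
  by apply: galoisS galQ; rewrite subvf sub1v.
have: a \in <<1; b>>%VS.
  rewrite -(galois_fixedField galb); apply/(fixedFieldP (memvf a)) => s s_b.
  have [u uE] := extend_algC_subfield_aut QnC s.
  apply: (fmorph_inj QnC); rewrite uE fix_a // -uE.
  congr (QnC _); exact: (fixed_gal (subvf _) s_b (memv_adjoin _ _)).
(* As b is algebraic, Q(b) consists of polynomials in b, so the denominator 1 suffices. *)
case/Fadjoin1_polyP=> p ->; exists p, 1.
rewrite rmorph1 hornerC oner_eq0 divr1; split=> //.
rewrite -horner_map -map_poly_comp; congr _.[_].
by apply: eq_map_poly => c /=; rewrite alg_num_field fmorph_rat.
Qed.

Lemma cfdot_irr_in_Qadjoin (gT : finGroupType) (H : {group gT}) (f : 'CF(H))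
    (i : Iirr H) (d : nat) (zeta : algC) :
  (0 < d)%N -> d.-primitive_root zeta -> (forall x, f x \in Crat) ->
  in_Qadjoin zeta '[f, 'chi_i] <->
  (forall u : {rmorphism algC -> algC},
     u zeta = zeta -> u '[f, 'chi_i] = '[f, 'chi_i]).
Proof.
move=> d_gt0 zetaP Qf; pose n := (#|H| * d)%N.
have n_gt0: (0 < n)%N by rewrite muln_gt0 cardG_gt0.
(* Any group of order n yields the n-th cyclotomic field, which contains zeta and, as |H| divides n,
   the character values of H. *)
have [Qn galQ [QnC _ [w [w_prim _] charQ]]] :=
  group_num_field_exists [set: 'I_n.-1.+1].
rewrite cardsT card_ord prednK // in w_prim charQ.
have [b <-]: exists b, QnC b = zeta.
  have QwP: n.-primitive_root (QnC w) by rewrite fmorph_primitive_root.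
  have zn1: zeta ^+ n = 1 by rewrite /n mulnC exprM (prim_expr_order zetaP) expr1n.
  have [j ->] := prim_rootP QwP zn1.
  by exists (w ^+ j); rewrite rmorphXn.
have [a <-]: exists a, QnC a = '[f, 'chi_i]; last exact: in_QadjoinP.
have fin_Q x: exists c, x \in H -> QnC c = f x * ('chi_i x)^*.
  have [Hx | _] := boolP (x \in H); last by exists 0.
  have [|c Dc] := charQ _ _ _ (irr_char (conjC_Iirr i)) x.
    by rewrite dvdn_mulr ?order_dvdG.
  have /CratP[q ->] := Qf x.
  by exists (ratr q * c) => _; rewrite rmorphM fmorph_rat Dc conjC_IirrE cfunE.
have /fin_all_exists[c Dc] := fin_Q.
exists (#|H|%:R^-1 * \sum_(x in H) c x).
rewrite cfdotE rmorphM fmorphV rmorph_nat rmorph_sum.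
by congr (_ * _); apply: eq_bigr => x /Dc.
Qed.

(** * Power maps and Galois conjugation of characters *)

Section PowerMap.

Variables (gT : finGroupType) (H : {group gT}).

(** This is the k-th Adams operation. The cut-off matters: x^k may lie in H when x does not. *)
Fact cfPow_subproof (k : nat) (phi : 'CF(H)) :
  is_class_fun <<H>> [ffun x => phi (x ^+ k)%g *+ (x \in H)].
Proof.
rewrite genGid; apply: intro_class_fun => [x y Hx Hy | x /negPf-> //].
by rewrite -conjXg cfunJ ?groupJr.
Qed.

Definition cfPow k phi := Cfun 1 (cfPow_subproof k phi).

Lemma cfPowE k phi x : x \in H -> cfPow k phi x = phi (x ^+ k)%g.
Proof. by move=> Hx; rewrite cfunElock Hx. Qed.

Lemma cfdot_pow k phi psi :
  coprime #|H| k -> '[cfPow k phi, cfPow k psi] = '[phi, psi].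
Proof.
move=> co_Hk; rewrite !cfdotE; congr (_ * _).
rewrite [RHS](reindex_onto (fun x => x ^+ k)%g
  (fun x => x ^+ expg_invn H k)%g) /=; last first.
  by move=> x Hx; rewrite expgAC expgK.
apply: eq_big => [x | x Hx]; last by rewrite !cfPowE.
apply/idP/andP=> [Hx | [Hxk /eqP <-]]; last exact: groupX.
by rewrite groupX ?expgK.
Qed.

Variables (u : {rmorphism algC -> algC}) (k : nat).
Hypothesis co_Hk : coprime #|H| k.
Hypothesis uk : forall z, z ^+ #|H| = 1 -> u z = z ^+ k.

(** The matrix of x is diagonalizable and its eigenvalues are |H|-th roots of unity, which u raises
    to the k-th power. *)
Lemma char_expg (chi : 'CF(H)) x :
  chi \is a character -> x \in H -> chi (x ^+ k)%g = u (chi x).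
Proof.
case/char_reprP=> rG -> Hx.
have [e [[B uB DrG] [e1 _] [-> _] _]] := repr_rsim_diag rG Hx.
have DrGX l: rG (x ^+ l)%g = invmx B *m diag_mx (map_mx (fun a => a ^+ l) e) *m B.
  elim: l => [|l IHl].
    rewrite repr_mx1 (_ : map_mx _ e = const_mx 1) ?diag_const_mx ?mulmx1 ?mulVmx //.
    by apply/rowP=> i; rewrite !mxE.
  rewrite expgS repr_mxM ?groupX // IHl DrG !mulmxA mulmxK //.
  rewrite -[_ *m _ *m diag_mx _]mulmxA mulmx_diag; congr (_ *m diag_mx _ *m _).
  by apply/rowP=> i; rewrite !mxE exprS.
rewrite cfunE groupX // DrGX mxtrace_mulC mulKVmx // mxtrace_diag rmorph_sum.
apply: eq_bigr => i _; rewrite mxE uk //.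
by have /dvdnP[q ->] := order_dvdG Hx; rewrite mulnC exprM e1 expr1n.
Qed.

Lemma cfAut_irrE i : cfAut u 'chi[H]_i = cfPow k 'chi_i.
Proof.
by apply/cfun_inP=> x Hx; rewrite cfPowE // cfunE char_expg ?irr_char.
Qed.

(** Compare coefficients at u(chi): for [cfPow k psi] it is that of psi at chi; for phi, which u
    fixes, it is u applied to that of phi at chi. *)
Lemma cfPow_eq (phi psi : 'CF(H)) :
    (forall x, phi x \in Crat) ->
  cfPow k psi = phi <-> (forall i, '[psi, 'chi_i] = u '[phi, 'chi_i]).
Proof.
move=> Qphi.
have phiu: cfAut u phi = phi.
  by apply/cfunP=> x; rewrite cfunE; have /CratP[q ->] := Qphi x; rewrite fmorph_rat.
have dotE i: '[phi, cfAut u 'chi_i] = u '[phi, 'chi_i].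
  by rewrite -cfdot_aut_irr phiu.
have dotkE i: '[cfPow k psi, cfAut u 'chi_i] = '[psi, 'chi_i].
  by rewrite cfAut_irrE cfdot_pow.
split=> [Dphi i | eq_dot]; first by rewrite -dotkE Dphi dotE.
rewrite [LHS]cfun_sum_cfdot [RHS]cfun_sum_cfdot; apply: eq_bigr => j _.
have [v _ uvK] := injF_bij (@aut_Iirr_inj _ H u).
by rewrite -[j]uvK aut_IirrE dotkE dotE eq_dot.
Qed.

End PowerMap.

(** * Quotients of elements of a conjugation-stable set *)

Section ClassDifferences.

Variables (gT : finGroupType) (H : {group gT}).
Implicit Type R : {set gT}.

Fact cfQuot_subproof R (nRH : H \subset 'N(R)) :
  is_class_fun <<H>>
    [ffun g => #|[set x in R | (g * x)%g \in R]|%:R *+ (g \in H)].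
Proof.
rewrite genGid; apply: intro_class_fun => [g y Hg Hy | g /negPf-> //].
rewrite groupJr // Hg; congr (_%:R *+ _).
have nRy := subsetP nRH y Hy.
rewrite -(card_imset [set x in R | (g * x)%g \in R] (conjg_inj y)).
apply: eq_card => x.
rewrite -[x](conjgKV y) (mem_imset _ _ (@conjg_inj _ y)) !inE -conjMg.
by rewrite !memJ_norm ?groupV.
Qed.

(* The value at [g] counts the factorizations [g = y * x^-1] with [x], [y] in [R]. *)
Definition cfQuot R nRH : 'CF(H) := Cfun 1 (@cfQuot_subproof R nRH).

Lemma cfQuotE R nRH g :
  g \in H -> @cfQuot R nRH g = #|[set x in R | (g * x)%g \in R]|%:R.
Proof. by move=> Hg; rewrite cfunElock Hg. Qed.

(* By Schur's lemma the sum of a conjugation-stable set acts as a scalar. *)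
Lemma irr_sum_normal R (i : Iirr H) x :
    R \subset H -> H \subset 'N(R) -> x \in H ->
  \sum_(y in R) 'chi_i (y * x)%g =
    (\sum_(y in R) 'chi_i y) * 'chi_i x / 'chi_i 1%g.
Proof.
move=> sRH nRH Hx; pose rG := 'Chi_i; pose M := \sum_(y in R) rG y.
have chiE y: y \in H -> 'chi_i y = \tr (rG y).
  by move=> Hy; rewrite -irrRepr cfunE Hy.
have cM: centgmx rG M.
  apply/centgmxP=> y Hy; rewrite mulmx_suml mulmx_sumr.
  rewrite [RHS](reindex_inj (conjg_inj y)) /=; apply: eq_big => z.
    by rewrite memJ_norm ?(subsetP nRH).
  move=> /(subsetP sRH) Hz.
  by rewrite -!repr_mxM ?groupJ // conjgC.
have /is_scalar_mxP[c DM]: is_scalar_mx M.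
  by apply: mx_abs_irr_cent_scalar cM; apply/groupC/socle_irr.
have trM y: y \in H -> \sum_(z in R) 'chi_i (z * y)%g = c * 'chi_i y.
  move=> Hy; rewrite chiE // -mxtraceZ -mul_scalar_mx -DM mulmx_suml raddf_sum.
  apply: eq_bigr => z /(subsetP sRH) Hz /=.
  by rewrite chiE ?groupM // repr_mxM.
(* Taking y = 1 determines the scalar: the sum of chi over R is c chi(1). *)
have := trM 1%g (group1 H); under eq_bigr do rewrite mulg1.
by move->; rewrite trM // mulrAC mulfK ?irr1_neq0 // mulrC.
Qed.

Lemma cfdot_Quot R nRH (i : Iirr H) : R \subset H ->
  '[@cfQuot R nRH, 'chi_i] =
    (\sum_(x in R) 'chi_i x) * (\sum_(x in R) 'chi_i x^-1%g)
      / (#|H|%:R * 'chi_i 1%g).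
Proof.
move=> sRH; rewrite cfdotE.
transitivity (#|H|%:R^-1 *
  \sum_(x in R) \sum_(y in R) 'chi_i (x * y^-1)%g).
  congr (_ * _).
  transitivity (\sum_(g in H) \sum_(x in R | (g * x)%g \in R) 'chi_i g^-1%g).
    apply: eq_bigr => g Hg; rewrite cfQuotE // -irr_inv sumr_const mulr_natl.
    by rewrite cardsE.
  rewrite (exchange_big_dep (mem R)) /=; last by move=> g x _ /andP[].
  apply: eq_bigr => x Rx; have Hx := subsetP sRH x Rx.
  (* Substitute g = y x^-1, so that g x = y and g^-1 = x y^-1. *)
  rewrite (reindex_inj (mulIg x^-1)%g) /=; apply: eq_big => y.
    rewrite Rx mulgKV; apply: andb_idl => /(subsetP sRH) Hy.
    by rewrite groupM ?groupV.
  by rewrite invMg invgK.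
rewrite exchange_big /=.
under eq_bigr => y Ry do
  rewrite irr_sum_normal ?groupV ?(subsetP sRH y Ry) // -mulrA.
rewrite -mulr_sumr -mulr_suml invfM mulrCA !mulrA; congr (_ * _).
by rewrite -!mulrA [_^-1 * _]mulrC !mulrA.
Qed.

(* The inner products of the two sides with irreducible characters are Galois
   conjugates, under an automorphism raising roots of unity to the [k]-th power. *)
Lemma card_quot_expg R k g : R \subset H -> H \subset 'N(R) ->
    coprime #|H| k -> g \in H -> let Rk := [set x ^+ k | x in R]%g in
  #|[set x in Rk | (g ^+ k * x)%g \in Rk]| = #|[set x in R | (g * x)%g \in R]|.
Proof.
move=> sRH nRH co_Hk Hg Rk.
have injk: {in R &, injective (fun x => x ^+ k)%g}.
  by apply: (sub_in2 _ (can_in_inj (expgK co_Hk))); apply/subsetP.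
have sRkH: Rk \subset H.
  by apply/subsetP=> _ /imsetP[x Rx ->]; rewrite groupX ?(subsetP sRH).
have nRkH: H \subset 'N(Rk).
  apply/subsetP=> y Hy; rewrite inE; apply/subsetP=> _ /imsetP[_ /imsetP[x Rx ->] ->].
  by rewrite conjXg (imset_f (fun x => x ^+ k)%g) ?memJ_norm ?(subsetP nRH).
have [u uk] := Qn_aut_exists (etrans (coprime_sym _ _) co_Hk).
have Qquot: forall x, cfQuot nRH x \in Crat.
  by move=> x; rewrite cfunElock rpredMn ?rpred_nat.
have/(cfPow_eq co_Hk uk _ Qquot): forall i,
    '[cfQuot nRkH, 'chi_i] = u '[cfQuot nRH, 'chi_i].
  move=> i; have uE x (Hx : x \in H) := esym (char_expg uk (irr_char i) Hx).
  rewrite !cfdot_Quot // fmorph_div !rmorphM !rmorph_sum rmorph_nat !big_imset //=.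
  rewrite uE ?expg1n //; congr (_ * _ / _); apply: eq_bigr => x /(subsetP sRH) Hx.
    by rewrite uE.
  by rewrite uE ?groupV // expVgn.
move/cfunP/(_ g); rewrite cfPowE // !cfQuotE ?groupX // => /eqP.
by rewrite eqr_nat => /eqP.
Qed.

End ClassDifferences.

(** * Symmetry of the counts; indicators as Fourier coefficients *)

Section Indicators.

Variables (gT : finGroupType) (G : {group gT}) (m : int).

Lemma zexpgX (x : gT) k : zexpg (x ^+ k)%g m = (zexpg x m ^+ k)%g.
Proof. by case: m => l /=; rewrite ?expVgn expgAC. Qed.

Lemma zexpg_in (x : gT) : x \in G -> zexpg x m \in G.
Proof. by move=> Gx; case: m => l /=; rewrite ?groupV groupX. Qed.

Lemma commute_zexpg (x : gT) : commute x (zexpg x m).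
Proof. by case: m => l; [apply: commuteX | apply/commuteV/commuteX]. Qed.

(** The m-th roots of z form a conjugation-stable subset of C_G(z). As the k-th power map is
    bijective on G, the roots of z^k are the k-th powers of those of z, and [card_quot_expg]
    applies. *)
Lemma card_gamma_set_expg k (z g : gT) :
    coprime #|G| k -> z \in G -> g \in 'C_G[z] ->
  #|gamma_set G m (z ^+ k)%g (g ^+ k)%g| = #|gamma_set G m z g|.
Proof.
move=> co_Gk Gz Cg; have [Gg _] := setIP Cg.
pose R := [set x in G | zexpg x m == z].
have gammaE w h : h \in G -> gamma_set G m w h =
    [set x in [set y in G | zexpg y m == w] |
       (h * x)%g \in [set y in G | zexpg y m == w]].
  move=> Gh; apply/setP=> x; rewrite !inE -andbA; case Gx: (x \in G) => //=.
  by rewrite groupM.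
have sRC: R \subset 'C_G[z].
  apply/subsetP=> x /setIdP[Gx /eqP <-]; rewrite inE Gx.
  exact/cent1P/commute_zexpg.
have nRC: 'C_G[z] \subset 'N(R).
  apply/subsetP=> y /setIP[Gy /cent1P zy]; rewrite inE.
  apply/subsetP=> _ /imsetP[x /setIdP[Gx /eqP xm] ->].
  by rewrite inE groupJ // zexpgJ xm conjgE -zy mulKg eqxx.
have co_Ck: coprime #|'C_G[z]| k by apply: coprime_dvdl co_Gk; apply/cardSg/subsetIl.
have inj_k := can_in_inj (expgK co_Gk).
have Rk: [set y in G | zexpg y m == z ^+ k]%g = [set x ^+ k | x in R]%g.
  apply/setP=> y; apply/setIdP/imsetP=> [[Gy /eqP ym] | [x /setIdP[Gx /eqP xm] ->]].
    have yk: y = (y ^+ expg_invn G k ^+ k)%g by rewrite expgAC expgK.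
    exists (y ^+ expg_invn G k)%g => //; rewrite inE groupX //=; apply/eqP.
    by apply: inj_k; rewrite ?zexpg_in ?groupX // -zexpgX -yk.
  by rewrite groupX // zexpgX xm.
by rewrite !gammaE ?groupX // Rk (card_quot_expg sRC nRC co_Ck Cg).
Qed.

Fact FSdual_subproof (g : gT) :
  is_class_fun <<'C_G[g]>>
    [ffun z => #|gamma_set G m z g|%:R *+ (z \in 'C_G[g])].
Proof.
rewrite genGid; apply: intro_class_fun => [z y Cz Cy | z /negPf-> //].
rewrite groupJr // Cz; congr (_%:R *+ _).
have [Gy /cent1P cgy] := setIP Cy.
have gJ: (g ^ y)%g = g by rewrite conjgE -cgy mulKg.
rewrite -(card_imset (gamma_set G m z g) (conjg_inj y)); apply: eq_card => x.
rewrite -[x](conjgKV y) (mem_imset _ _ (@conjg_inj _ y)) !inE.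
by rewrite -{1}gJ -conjMg !zexpgJ !(inj_eq (conjg_inj y)) groupJr.
Qed.

Definition FSdual g : 'CF('C_G[g]) := Cfun 1 (FSdual_subproof g).

Lemma FSdualE g z : z \in 'C_G[g] -> FSdual g z = #|gamma_set G m z g|%:R.
Proof. by move=> Cz; rewrite cfunElock Cz. Qed.

Lemma FSgammaE z g : g \in 'C_G[z] -> FSgamma G m z g = #|gamma_set G m z g|%:R.
Proof. by move=> Cg; rewrite cfunElock Cg. Qed.

(** Group the x by z = x^m, which centralizes g. The conjugate character compensates for the
    conjugation in the inner product. *)
Lemma FSind_cfdot g (i : Iirr 'C_G[g]) : g \in G ->
  FSind m 'chi_i = '[FSdual g, 'chi_(conjC_Iirr i)].
Proof.
move=> Gg; rewrite cfdotE; congr (_ * _).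
rewrite (partition_big (fun x => zexpg x m) (mem 'C_G[g])) /= => [|x].
  apply: eq_bigr => z Cz; rewrite FSdualE // conjC_IirrE cfunE conjCK.
  rewrite mulr_natl -sumr_const; apply: eq_big => [x | x /andP[_ /eqP->] //].
  rewrite !inE -andbA; congr (_ && _).
  by rewrite andbC; case: eqP => //= ->; rewrite eq_sym.
case/andP=> Gx /eqP eq_m; rewrite inE zexpg_in //=; apply/cent1P.
rewrite -[g](mulgK x); apply: commuteM; last first.
  exact/commuteV/commute_sym/commute_zexpg.
by rewrite /commute {1 2}eq_m; apply/commute_sym/commute_zexpg.
Qed.

End Indicators.

(** Apply [cfPow_eq] with both functions equal to f. Taking k relative to |G| instead of |H| lets
    the same u and k serve all centralizers. *)
Lemma cfdot_irr_Qadjoin_expg (gT : finGroupType) (G H : {group gT}) (f : 'CF(H))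
    (d : nat) (zeta : algC) :
    (0 < d)%N -> d.-primitive_root zeta ->
    H \subset G -> (forall x, f x \in Crat) ->
  (forall i, in_Qadjoin zeta '[f, 'chi_i]) <->
  (forall (u : {rmorphism algC -> algC}) k,
     u zeta = zeta -> coprime #|G| k ->
     (forall z, z ^+ #|G| = 1 -> u z = z ^+ k) ->
   forall x, x \in H -> f (x ^+ k)%g = f x).
Proof.
move=> d_gt0 zetaP sHG Qf.
have in_QP i := cfdot_irr_in_Qadjoin i d_gt0 zetaP Qf.
have powP (u : {rmorphism algC -> algC}) k : coprime #|G| k ->
    (forall z, z ^+ #|G| = 1 -> u z = z ^+ k) ->
  cfPow k f = f <-> (forall i, '[f, 'chi_i] = u '[f, 'chi_i]).
  move=> co_Gk uk; apply: cfPow_eq => // [|z zH1].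
    exact: coprime_dvdl (cardSg sHG) co_Gk.
  by apply: uk; have /dvdnP[q ->] := cardSg sHG; rewrite mulnC exprM zH1 expr1n.
split=> [Qchi u k uz co_Gk uk x Hx | f_exp i].
  rewrite -cfPowE //; congr (fun_of_cfun _ x); apply/(powP u) => // i.
  by rewrite (in_QP i).1.
apply/in_QP=> u uz.
(* The action of u on a primitive |G|-th root of unity provides k. *)
have [w w_prim] := C_prim_root_exists (cardG_gt0 G).
have [k co_kG uw] := aut_prim_rootP u w_prim.
have co_Gk: coprime #|G| k by rewrite coprime_sym.
have uk z: z ^+ #|G| = 1 -> u z = z ^+ k.
  by case/(prim_rootP w_prim)=> j ->; rewrite rmorphXn /= uw exprAC.
symmetry; move: i; apply/(powP u k co_Gk uk)/cfun_inP=> x Hx.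
by rewrite cfPowE // (f_exp u).
Qed.

Theorem proposition8p4 (gT : finGroupType) (G : {group gT}) (m : int) (d : nat)
    (zeta : algC) (d_gt0 : (0 < d)%N) (zetaP : d.-primitive_root zeta) :
  (forall (g : gT) (i : Iirr 'C_G[g]), g \in G ->
     in_Qadjoin zeta (FSind m 'chi_i))
  <->
  (forall (z : gT) (i : Iirr 'C_G[z]), z \in G ->
     in_Qadjoin zeta (FSbeta m i)).
Proof.
have Qdual g x: FSdual G m g x \in Crat by rewrite cfunElock rpredMn ?rpred_nat.
have Qgamma z x: FSgamma G m z x \in Crat by rewrite cfunElock rpredMn ?rpred_nat.
have dualP g := cfdot_irr_Qadjoin_expg d_gt0 zetaP (subsetIl G _) (Qdual g).
have gammaP z := cfdot_irr_Qadjoin_expg d_gt0 zetaP (subsetIl G _) (Qgamma z).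
have cent_sym (x y : gT) : x \in G -> y \in 'C_G[x] -> x \in 'C_G[y].
  by move=> Gx /setIP[_ cxy]; rewrite inE Gx cent1C.
split=> [Qind z i Gz | Qbeta g i Gg].
  rewrite /FSbeta coord_cfdot; move: i; apply/gammaP=> u k uz co_Gk uk g Cg.
  have Gg := subsetP (subsetIl _ _) g Cg.
  (* By symmetry it remains to show F(g^k, z) = F(g^k, z^k), the criterion for [FSdual] at g^k. *)
  rewrite !FSgammaE ?groupX // -(card_gamma_set_expg m co_Gk Gz Cg).
  have Cz := cent_sym _ _ Gz Cg.
  have Ck: z \in 'C_G[g ^+ k] by rewrite cent_sym ?groupX.
  rewrite -!FSdualE ?groupX //; apply/esym.
  apply: ((dualP _).1 _ u k) Ck => // i.
  by rewrite -[i]conjC_IirrK -FSind_cfdot ?groupX //; apply: Qind; rewrite groupX.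
rewrite FSind_cfdot //; move: (conjC_Iirr i) => {}i; move: i.
apply/dualP=> u k uz co_Gk uk z Cz.
have Gz := subsetP (subsetIl _ _) z Cz; have Cg := cent_sym _ _ Gg Cz.
(* Here F(g, z^k) = F(g^k, z^k) remains, the criterion for [FSgamma] at z^k. *)
rewrite !FSdualE ?groupX // -(card_gamma_set_expg m co_Gk Gz Cg).
have Ck: g \in 'C_G[z ^+ k] by rewrite cent_sym ?groupX.
rewrite -!FSgammaE ?groupX //; apply/esym.
apply: ((gammaP _).1 _ u k) Ck => // i.
by rewrite -coord_cfdot; apply: Qbeta; rewrite groupX.
Qed.
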